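(* Let $\mathcal{L}$ be the declared leakage (a classical random variable) and consider any $n$-qubit register delegated by the client to the server in Protocol 1 or Protocol 2 (described in the context). Suppose that for this register the client samples fresh, uniform and secret quantum one-time pad keys $x,z\in\{0,1\}^n$, independently of the plaintext state of the register and of $\mathcal{L}$. The client sends $P_{x,z}\,\rho\,P_{x,z}^{\dagger}$, where $\rho$ is the plaintext state, and while the server holds the register it applies the prescribed public Clifford operations. Then, both in the strict honest-but-curious model and in the purified honest-but-curious model for ancillas compatible with the prescribed public Clifford implementation, the server's quantum marginal for the encrypted delegated register (averaged over the keys, which the server does not know) is maximally mixed conditioned on $\mathcal{L}$: it equals $I/2^n$ for every value of $\mathcal{L}$ and every plaintext state $\rho$, both on reception and after any prescribed sequence of public Clifford operations. Consequently the only remaining information is the declared leakage.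
   Context: For bit strings $x,z\in\{0,1\}^n$, $P_{x,z}=\bigotimes_{j=1}^n X^{x_j}Z^{z_j}$, where $X,Z$ are the single-qubit Pauli matrices. Quantum one-time pad (QOTP) encryption with key $(x,z)$ maps an $n$-qubit density matrix $\rho$ to $P_{x,z}\rho P_{x,z}^\dagger$. A Clifford operation $C$ is a unitary normalizing the $n$-qubit Pauli group, so that $CP_{x,z}=\omega P_{x',z'}C$ for some phase $\omega$ and updated key $(x',z')$; the client tracks this update classically and privately. Protocols 1 and 2: a client who can hold only $M$ qubits runs an $N$-qubit circuit ($N>M$) with the help of one server used as quantum memory. Every register sent to the server is first QOTP-encrypted by the client with fresh keys. While the server stores encrypted registers, it is asked to apply only public Clifford operations, specified by public instructions that are part of the declared leakage. All private operations and all non-Clifford operations are performed by the client on returned and decrypted qubits, which are then freshly re-encrypted before being sent back. In Protocol 1 the client can apply arbitrary gates on its $M$ qubits; in Protocol 2 the client has $M$ independent single-qubit devices (only single-qubit gates and hidden permutations of physical ports). Declared leakage $\mathcal{L}$: the metadata the protocol allows the server to learn, such as register size, timing, routing leakage and the public gate pattern. Strict honest-but-curious model: the server applies exactly the prescribed channels and retains its classical transcript and the quantum systems it is given. Purified honest-but-curious model: additionally, the server may implement each prescribed channel $\mathcal E$ (here conjugation by a public Clifford) by a unitary $U$ with an ancilla/environment $E$ such that $\mathcal E(\rho)=\operatorname{Tr}_E[U(\rho\otimes|0\rangle\langle 0|_E)U^\dagger]$, and keep $E$. *)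

(* Defs.v *)
From Stdlib Require List.
From HB Require Import structures.
From mathcomp Require Import all_boot all_order all_algebra.
From mathcomp Require Import complex mxtens.
From mathcomp Require Import all_classical all_reals all_analysis.

Set Implicit Arguments.
Unset Strict Implicit.
Unset Printing Implicit Defensive.

Import Order.TTheory GRing.Theory Num.Theory.
Import numFieldNormedType.Exports.

Local Open Scope classical_set_scope.
Local Open Scope ring_scope.
Local Open Scope sesquilinear_scope.

Section Qubits.
Variable C : numClosedFieldType.

Definition sigmaX : 'M[C]_2 := \matrix_(i, j) (i != j)%:R.

Definition sigmaZ : 'M[C]_2 := \matrix_(i, j) ((-1) ^+ i *+ (i == j)).

Fixpoint tensor_qubits (n : nat) : ('I_n -> 'M[C]_2) -> 'M[C]_(2 ^ n) :=
  match n with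
  | 0 => fun _ => 1%:M
  | m.+1 => fun A =>
      castmx (esym (expnS 2 m), esym (expnS 2 m))
        (A ord0 *t tensor_qubits (fun j => A (lift ord0 j)))
  end.

Definition pauli n (x z : n.-tuple bool) : 'M[C]_(2 ^ n) :=
  tensor_qubits (fun j => sigmaX ^+ tnth x j *m sigmaZ ^+ tnth z j).

Definition pauli_group n (Q : 'M[C]_(2 ^ n)) : Prop :=
  exists (k : nat) (x z : n.-tuple bool), Q = 'i ^+ k *: pauli x z.

Definition conjugate_by m p (A : 'M[C]_(p, m)) (rho : 'M[C]_m) : 'M[C]_p :=
  A *m rho *m A ^t*.

Definition clifford n (G : 'M[C]_(2 ^ n)) : Prop :=
  G \is unitarymx /\
  forall Q, pauli_group (conjugate_by G Q) <-> pauli_group Q.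

Definition density m (rho : 'M[C]_m) : Prop :=
  [/\ rho ^t* = rho,
      forall v : 'cV[C]_m, 0 <= (v ^t* *m rho *m v) ord0 ord0
    & \tr rho = 1].

Definition max_mixed n : 'M[C]_(2 ^ n) := ((2 ^ n)%:R^-1)%:M.

Definition qotp n (x z : n.-tuple bool) (rho : 'M[C]_(2 ^ n)) : 'M[C]_(2 ^ n) :=
  conjugate_by (pauli x z) rho.

Definition strict_run n (cs : seq 'M[C]_(2 ^ n)) (rho : 'M[C]_(2 ^ n)) :=
  foldl (fun s G => conjugate_by G s) rho cs.

(* Partial trace over the second tensor factor. *)
Definition ptrace m d (J : 'M[C]_(m * d)) : 'M[C]_m :=
  \matrix_(i, j) \sum_(k < d) J (mxtens_index (i, k)) (mxtens_index (j, k)).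

(* The ancilla has dimension anc.+1, so that its initial state |0> exists. *)
Record dilation n := Dilation {
  anc : nat;
  joint_unitary : 'M[C]_(2 ^ n * anc.+1)
}.

Definition implements n (D : dilation n) (G : 'M[C]_(2 ^ n)) : Prop :=
  joint_unitary D \is unitarymx /\
  forall rho : 'M[C]_(2 ^ n), density rho ->
    conjugate_by G rho =
    ptrace (conjugate_by (joint_unitary D) (rho *t delta_mx ord0 ord0)).

Definition implements_seq n (Ds : seq (dilation n)) (cs : seq 'M[C]_(2 ^ n)) :=
  List.Forall2 (@implements n) Ds cs.

(* The isometry psi |-> psi (x) |0>. *)
Definition attach_ancilla m e : 'M[C]_(m * e.+1, m) :=
  \matrix_(i, j) (i == mxtens_index (j, ord0))%:R.

(* One step on the register and the environment (of dimension d) kept so far: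
   a fresh ancilla in state |0> is placed between them, and the joint unitary
   acts on the register and this ancilla, which then joins the environment. *)
Definition purified_step n (D : dilation n) d (J : 'M[C]_(2 ^ n * d)) :
    'M[C]_(2 ^ n * ((anc D).+1 * d)) :=
  castmx (esym (mulnA (2 ^ n)%N (anc D).+1 d),
          esym (mulnA (2 ^ n)%N (anc D).+1 d))
    (conjugate_by
       ((joint_unitary D *m attach_ancilla (2 ^ n) (anc D)) *t (1%:M : 'M[C]_d))
       J).

Fixpoint env_dim n (Ds : seq (dilation n)) (d : nat) : nat :=
  if Ds is D :: Ds' then env_dim Ds' ((anc D).+1 * d) else d.

Fixpoint purified_run_from n (Ds : seq (dilation n)) :
    forall d, 'M[C]_(2 ^ n * d) -> 'M[C]_(2 ^ n * env_dim Ds d) :=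
  match Ds with
  | [::] => fun d J => J
  | D :: Ds' => fun d J => purified_run_from Ds' (purified_step D J)
  end.

(* Joint state of the register and of all kept ancillas; the environment is
   initially trivial (dimension 1). *)
Definition purified_run n (Ds : seq (dilation n)) (rho : 'M[C]_(2 ^ n)) :
    'M[C]_(2 ^ n * env_dim Ds 1) :=
  purified_run_from Ds (rho *t (1%:M : 'M[C]_1)).

End Qubits.

Section RandomStates.
Context {R : realType} {d : measure_display} {T : measurableType d}.
Variable P : probability T R.

Definition measurable_state m (f : T -> 'M[R[i]]_m) : Prop :=
  forall i j, measurable_fun setT (fun w => complex.Re (f w i j)) /\
              measurable_fun setT (fun w => complex.Im (f w i j)).

(* E[f | B], entrywise, for an event B of positive probability.  Conditioning on
   a leakage L is conditioning on the events L @^-1` A; A = [set l] conditions on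
   the value l, and for an L without atoms these events determine the conditional
   expectation given L. *)
Definition cond_state m (B : set T) (f : T -> 'M[R[i]]_m) : 'M[R[i]]_m :=
  \matrix_(i, j)
    Complex ((\int[P]_(w in B) complex.Re (f w i j)) / fine (P B))
            ((\int[P]_(w in B) complex.Im (f w i j)) / fine (P B)).

(* The sigma-algebra generated by the leakage and the plaintext state. *)
Definition leakage_plaintext_events dL (Lam : measurableType dL) (L : T -> Lam)
    m (rho : T -> 'M[R[i]]_m) : set (set T) :=
  <<s [set B | (exists2 A, measurable A & B = L @^-1` A) \/
               exists i j (S : set R), measurable S /\
                 (B = [set w | S (complex.Re (rho w i j))] \/
                  B = [set w | S (complex.Im (rho w i j))])] >>.

Definition key_event n (x z : T -> n.-tuple bool) (a b : n.-tuple bool) : set T :=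
  [set w | x w = a /\ z w = b].

Definition uniform_keys n (x z : T -> n.-tuple bool) : Prop :=
  forall a b, P (key_event x z a b) = ((4 ^ n)%:R^-1 : R)%:E.

Definition independent_keys n (x z : T -> n.-tuple bool)
    dL (Lam : measurableType dL) (L : T -> Lam)
    (rho : T -> 'M[R[i]]_(2 ^ n)) : Prop :=
  forall a b B, leakage_plaintext_events L rho B ->
    P (key_event x z a b `&` B) = (P (key_event x z a b) * P B)%E.

End RandomStates.

(* Main.v *)
(* The matrix entries of the Pauli operators are orthogonal as functions of the
   key: the sum over all keys of [P i k * conj (P j l)] is [2 ^ n] if [i = j] and
   [k = l], and 0 otherwise.  Hence averaging [P rho P^*] over a uniform key
   independent of [rho] replaces [rho] by its trace times [I / 2 ^ n], also
   conditionally on any event that is independent of the key.  Conditional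
   averaging commutes with linear maps, and both the strict and the purified
   behaviour of the server are linear in the state; so it suffices that the
   server's channels fix the maximally mixed state.  This holds for a unitary
   conjugation; for a dilation, the partial trace of a purified step depends only
   on the partial trace of its input, through the prescribed channel. *)
Require Import Defs.
From HB Require Import structures.
From mathcomp Require Import all_boot all_order all_algebra.
From mathcomp Require Import complex mxtens.
From mathcomp Require Import all_classical all_reals all_analysis.
From mathcomp Require Import measurable_realfun lra.

Set Implicit Arguments.
Unset Strict Implicit.
Unset Printing Implicit Defensive.

Import Order.TTheory GRing.Theory Num.Theory.

Local Open Scope classical_set_scope.
Local Open Scope ring_scope.
Local Open Scope sesquilinear_scope.

(** * Orthogonality of the Pauli entries over the keys *)

Section Qubits.
Variable C : numClosedFieldType.

(** The entry of [X^b Z^c] at [(p, q)] is a sign [(-1)^(c q)] if [b] tells whether [p != q], and 0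
    otherwise. Summing the signs over [c] forces [k = l]; the shared bit [b] then forces [i = j]. *)
Lemma single_pauli_sum (i j k l : 'I_2) :
  \sum_(b : bool * bool)
    (sigmaX C ^+ b.1 *m sigmaZ C ^+ b.2) i k *
    ((sigmaX C ^+ b.1 *m sigmaZ C ^+ b.2) j l)^*
  = 2%:R * ((i == j) && (k == l))%:R.
Proof.
have pauliE (b c : bool) (p q : 'I_2) :
    (sigmaX C ^+ b *m sigmaZ C ^+ c) p q =
      (b == (p != q))%:R * (-1) ^+ (c && (q == 1)).
  have XE : (sigmaX C ^+ b) = \matrix_(r, s) (b == (r != s))%:R.
    apply/matrixP => r s.
    by case: b; rewrite ?expr1 ?expr0 !mxE; case: (r == s).
  have ZE : (sigmaZ C ^+ c) =
      \matrix_(r, s) ((-1) ^+ (c && (s == 1)) *+ (r == s)).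
    apply/matrixP => r s.
    case: c; rewrite ?expr1 ?expr0 !mxE//=.
    by case: s => -[|[|//]] ?; case: r => -[|[|//]] ?.
  rewrite XE ZE !mxE (bigD1 q)//= big1 ?addr0 => [|r rq].
    by rewrite !mxE eqxx.
  by rewrite !mxE (negPf rq) mulr0.
rewrite -(pair_bigA _ (fun b c : bool => (sigmaX C ^+ b *m sigmaZ C ^+ c) i k *
  ((sigmaX C ^+ b *m sigmaZ C ^+ c) j l)^*)) /= !big_bool.
rewrite !pauliE /=.
case: i => -[|[|//]] ?; case: j => -[|[|//]] ?;
case: k => -[|[|//]] ?; case: l => -[|[|//]] ?;
  rewrite -!val_eqE /= ?(mulr0, mul0r, mulr1, mul1r, rmorphN, rmorph1, rmorph0,
    expr0, expr1, addr0, add0r, mulrNN, mulrN, mulNr, subrr, addNr, opprK, oppr0)//.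
Qed.

Lemma pauli_cons n (b c : bool) (x z : n.-tuple bool) :
  pauli C (cons_tuple b x) (cons_tuple c z) =
  castmx (esym (expnS 2 n), esym (expnS 2 n))
    ((sigmaX C ^+ b *m sigmaZ C ^+ c) *t pauli C x z).
Proof.
rewrite /pauli /= !tnth0; congr (castmx _ (_ *t tensor_qubits _)).
by apply/funext => j; rewrite !tnthS.
Qed.

Lemma mxtens_castP n (i : 'I_(2 ^ n.+1)) :
  {p : 'I_2 * 'I_(2 ^ n) | i = cast_ord (esym (expnS 2 n)) (mxtens_index p)}.
Proof.
exists (mxtens_unindex (cast_ord (expnS 2 n) i)).
by rewrite mxtens_unindexK cast_ordK.
Qed.

(** Induction on the number of qubits: the entries of a tensor product multiply, so the sum over all
    keys factors into the first qubit's sum and that of the others. *)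
Lemma pauli_sum n (i j k l : 'I_(2 ^ n)) :
  \sum_(p : n.-tuple bool * n.-tuple bool)
    pauli C p.1 p.2 i k * (pauli C p.1 p.2 j l)^*
  = (2 ^ n)%:R * ((i == j) && (k == l))%:R.
Proof.
elim: n i j k l => [|n IHn] i j k l.
  rewrite (ord1 i) (ord1 j) (ord1 k) (ord1 l) !eqxx mulr1.
  under eq_bigr do rewrite !mxE eqxx /= conjC1 mulr1.
  by rewrite sumr_const card_prod !card_tuple.
have [[i1 i2] ->] := mxtens_castP i.
have [[j1 j2] ->] := mxtens_castP j.
have [[k1 k2] ->] := mxtens_castP k.
have [[l1 l2] ->] := mxtens_castP l.
(* Regroups a key by qubit: the two bits of the first qubit, then the keys of the rest. *)
pose h (p : (bool * bool) * (n.-tuple bool * n.-tuple bool)) :=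
  (cons_tuple p.1.1 p.2.1, cons_tuple p.1.2 p.2.2).
have hbij : bijective h.
  exists (fun q => ((thead q.1, thead q.2), (behead_tuple q.1, behead_tuple q.2))).
    move=> [[b c] [x z]]; rewrite /h /=.
    by congr ((_, _), (_, _)); apply/val_inj.
  move=> [x z]; case/tupleP: x => b x; case/tupleP: z => c z.
  by congr (_, _); apply/val_inj.
rewrite (reindex h) /=; last exact: onW_bij.
transitivity (
  (\sum_(b : bool * bool) (sigmaX C ^+ b.1 *m sigmaZ C ^+ b.2) i1 k1 *
    ((sigmaX C ^+ b.1 *m sigmaZ C ^+ b.2) j1 l1)^*) *
  (\sum_(p : n.-tuple bool * n.-tuple bool)
    pauli C p.1 p.2 i2 k2 * (pauli C p.1 p.2 j2 l2)^*)).
  rewrite big_distrlr /= pair_big /=; apply: eq_bigr => -[[b c] [x z]] _ /=.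
  by rewrite pauli_cons !castmxE /= !cast_ordK !tensmxE rmorphM mulrACA.
rewrite single_pauli_sum IHn !(inj_eq (@cast_ord_inj _ _ _)).
rewrite !(can_eq (@mxtens_indexK _ _)) !xpair_eqE mulrACA expnS natrM.
by rewrite -[X in _ * X = _]natrM mulnb andbACA.
Qed.


(** * Linearity of the strict and purified runs *)

Lemma conjugate_by_linear m p (A : 'M[C]_(p, m)) : linear (conjugate_by A).
Proof.
by move=> a u v; rewrite /conjugate_by mulmxDr mulmxDl -scalemxAr -scalemxAl.
Qed.

Lemma conjugate_by_mul m p q (A : 'M[C]_(q, p)) (B : 'M[C]_(p, m)) rho :
  conjugate_by (A *m B) rho = conjugate_by A (conjugate_by B rho).
Proof. by rewrite /conjugate_by trmx_mul map_mxM !mulmxA. Qed.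

Lemma conjugate_byE m p (A : 'M[C]_(p, m)) rho i j :
  conjugate_by A rho i j = \sum_k \sum_l A i k * (A j l)^* * rho k l.
Proof.
rewrite !mxE exchange_big /=; apply: eq_bigr => l _.
rewrite !mxE mulr_suml; apply: eq_bigr => k _.
by rewrite mulrAC.
Qed.

Lemma ptrace_linear m e : linear (@ptrace C m e).
Proof.
move=> a u v; apply/matrixP => i j; rewrite !mxE mulr_sumr -big_split /=.
by apply: eq_bigr => k _; rewrite !mxE.
Qed.

Lemma purified_step_linear n (D : dilation C n) e :
  linear (@purified_step C n D e).
Proof.
move=> a u v; apply/matrixP => i j.
by rewrite /purified_step conjugate_by_linear !(castmxE, mxE).
Qed.

Lemma purified_run_from_linear n (Ds : seq (dilation C n)) e :
  linear (@purified_run_from C n Ds e).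
Proof.
elim: Ds e => [//|D Ds IH] e a u v.
by rewrite /= purified_step_linear IH.
Qed.

Lemma purified_run_linear n (Ds : seq (dilation C n)) : linear (purified_run Ds).
Proof.
move=> a u v; rewrite /purified_run -purified_run_from_linear.
congr (purified_run_from _ _); apply/matrixP => i j.
by rewrite !mxE mulrDl mulrA.
Qed.

Lemma strict_run_linear n (cs : seq 'M[C]_(2 ^ n)) : linear (strict_run cs).
Proof.
elim: cs => [//|G cs IH] a u v.
by rewrite /strict_run /= conjugate_by_linear; exact: IH.
Qed.

(** * Invariance of the maximally mixed state *)

Lemma conjugate_max_mixed n (G : 'M[C]_(2 ^ n)) :
  G \is unitarymx -> conjugate_by G (max_mixed C n) = max_mixed C n.
Proof.
move=> /unitarymxP GG; rewrite /conjugate_by /max_mixed.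
by rewrite mul_mx_scalar -scalemxAl GG scale_scalar_mx mulr1.
Qed.

Lemma strict_run_max_mixed n (cs : seq 'M[C]_(2 ^ n)) :
  {in cs, forall G, G \is unitarymx} ->
  strict_run cs (max_mixed C n) = max_mixed C n.
Proof.
elim: cs => [//|G cs IH] csU; rewrite /strict_run /= conjugate_max_mixed.
  by apply: IH => H Hcs; apply: csU; rewrite inE Hcs orbT.
by apply: csU; rewrite inE eqxx.
Qed.

(** Needed because [implements] constrains a dilation on density matrices only. *)
Lemma density_max_mixed n : density (max_mixed C n).
Proof.
split.
- rewrite /max_mixed tr_scalar_mx map_scalar_mx.
  by rewrite fmorphV /= conjC_nat.
- move=> v; rewrite /max_mixed mul_mx_scalar -scalemxAl !mxE.
  rewrite mulr_ge0 ?invr_ge0 ?ler0n// sumr_ge0// => i _.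
  by rewrite !mxE mulrC mul_conjC_ge0.
- rewrite /max_mixed mxtrace_scalar -(mulr_natr (_^-1)) mulVf//.
Qed.

(** Links the isometry used in [purified_step] with the product state used in [implements]. *)
Lemma conjugate_attach_ancilla m e (rho : 'M[C]_m) :
  conjugate_by (attach_ancilla C m e) rho = rho *t delta_mx ord0 ord0.
Proof.
apply/matrixP => i j.
case: (mxtens_indexP i) => i1 i2; case: (mxtens_indexP j) => j1 j2.
rewrite conjugate_byE tensmxE !mxE (bigD1 i1)//= (bigD1 j1)//=.
rewrite !mxE !(can_eq (@mxtens_indexK _ _)) !xpair_eqE !eqxx /=.
rewrite conjC_nat big1 => [|l lj]; last first.
  rewrite !mxE !(can_eq (@mxtens_indexK _ _)) !xpair_eqE.
  by rewrite [j1 == l]eq_sym (negPf lj) /= conjC0 mulr0 mul0r.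
rewrite big1 => [|k ki]; last first.
  rewrite big1// => l _.
  rewrite !mxE !(can_eq (@mxtens_indexK _ _)) !xpair_eqE.
  by rewrite [i1 == k]eq_sym (negPf ki) /= !mul0r.
by rewrite !addr0 -natrM mulnb mulrC.
Qed.

Lemma big_mxtens_index m e (F : 'I_(m * e) -> C) :
  \sum_i F i = \sum_(p < m) \sum_(q < e) F (mxtens_index (p, q)).
Proof.
rewrite pair_big /= (reindex (@mxtens_index m e)) /=.
  by apply: eq_bigr => -[].
by apply: onW_bij; exists (@mxtens_unindex m e);
  [exact: mxtens_indexK|exact: mxtens_unindexK].
Qed.

Lemma cast_mxtens_index m e f (i : 'I_m) (a : 'I_e) (k : 'I_f) :
  cast_ord (mulnA m e f) (mxtens_index (i, mxtens_index (a, k))) =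
  mxtens_index (mxtens_index (i, a), k).
Proof. by apply/val_inj; rewrite /= mulnDl addnA mulnA. Qed.

(** The step acts as the identity on the old environment, so that environment can be traced out
    before the step instead of after it. *)
Lemma ptrace_purified_step n (D : dilation C n) e (J : 'M[C]_(2 ^ n * e)) :
  ptrace (purified_step D J) =
  ptrace (conjugate_by (joint_unitary D) (ptrace J *t delta_mx ord0 ord0)).
Proof.
rewrite -conjugate_attach_ancilla -conjugate_by_mul /purified_step.
move: (joint_unitary D *m _) => V; apply/matrixP => i j; rewrite !mxE.
rewrite big_mxtens_index; apply: eq_bigr => a _.
under eq_bigr => k _.
  rewrite castmxE /= !esymK !cast_mxtens_index conjugate_byE.
  rewrite big_mxtens_index.
  under eq_bigr => p _.
    (* The identity factor keeps only the term whose old environment index is the traced index [k];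
       the same happens for the conjugated factor below. *)
    rewrite (bigD1 k)//= [X in _ + X]big1 ?addr0; last first.
      move=> q qk; rewrite big1// => r _.
      by rewrite tensmxE !mxE [k == q]eq_sym (negPf qk) mulr0 !mul0r.
    rewrite big_mxtens_index.
    under eq_bigr => r _.
      rewrite (bigD1 k)//= [X in _ + X]big1 ?addr0; last first.
        move=> q qk; rewrite !tensmxE !mxE [k == q]eq_sym (negPf qk).
        by rewrite mulr0 conjC0 mulr0 mul0r.
      rewrite !tensmxE !mxE eqxx !mulr1.
      over.
    over.
  over.
(* Moving the sum over [k] innermost leaves it on the entries of [J] alone, where it is
   [ptrace J]. *)
rewrite conjugate_byE exchange_big /=; apply: eq_bigr => p _.
rewrite exchange_big /=; apply: eq_bigr => r _.
by rewrite -mulr_sumr mxE.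
Qed.

(** Stated for an arbitrary joint state with maximally mixed marginal, since the environment grows
    and may be entangled with the register. Only the marginal is the invariant of the induction. *)
Lemma ptrace_purified_run_from n (Ds : seq (dilation C n)) cs :
  implements_seq Ds cs -> {in cs, forall G, G \is unitarymx} ->
  forall e (J : 'M[C]_(2 ^ n * e)), ptrace J = max_mixed C n ->
  ptrace (purified_run_from Ds J) = max_mixed C n.
Proof.
elim => {Ds cs} [|D G Ds cs [_ DG] _ IH] csU e J trJ //=.
apply: IH => [H Hcs|]; first by apply: csU; rewrite inE Hcs orbT.
rewrite ptrace_purified_step trJ -DG; last exact: density_max_mixed.
by rewrite conjugate_max_mixed// csU// inE eqxx.
Qed.

Lemma ptrace_purified_run n (Ds : seq (dilation C n)) cs :
  implements_seq Ds cs -> {in cs, forall G, G \is unitarymx} ->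
  ptrace (purified_run Ds (max_mixed C n)) = max_mixed C n.
Proof.
move=> impl csU; apply: ptrace_purified_run_from csU _ _ _ => //.
apply/matrixP => i j.
by rewrite mxE big_ord1 tensmxE [X in _ * X]mxE eqxx mulr1.
Qed.

End Qubits.

(** * Integrals of bounded real functions and independence *)

Section RealIntegrals.
Context {R : realType} {d : measure_display} {T : measurableType d}.
Variable P : probability T R.

(** A class closed under sums and products whose members are integrable on every measurable event,
    as the measure is finite; it discharges all integrability conditions. *)
Definition bounded_measurable (g : T -> R) : Prop :=
  measurable_fun setT g /\ exists M, forall w, `|g w| <= M.

Lemma bounded_measurable_cst r : bounded_measurable (fun=> r).
Proof. by split; [exact: measurable_cst|exists `|r|]. Qed.

Lemma bounded_measurableD f g : bounded_measurable f -> bounded_measurable g ->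
  bounded_measurable (fun w => f w + g w).
Proof.
move=> [mf [M fM]] [mg [N gN]]; split; first exact: measurable_funD.
by exists (M + N) => w; rewrite (le_trans (ler_normD _ _))// lerD.
Qed.

Lemma bounded_measurableM f g : bounded_measurable f -> bounded_measurable g ->
  bounded_measurable (fun w => f w * g w).
Proof.
move=> [mf [M fM]] [mg [N gN]]; split; first exact: measurable_funM.
by exists (M * N) => w; rewrite normrM ler_pM.
Qed.

Lemma bounded_measurable_indic (K : set T) :
  measurable K -> bounded_measurable (\1_K : T -> R).
Proof.
move=> mK; split; first exact: measurable_indic.
by exists 1 => w; rewrite indicE normr_nat lern1 leq_b1.
Qed.

Lemma bounded_measurable_integrable (mu : {finite_measure set T -> \bar R})
    (B : set T) g :
  measurable B -> bounded_measurable g -> mu.-integrable B (EFin \o g).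
Proof.
move=> mB [mg [M gM]]; apply: measurable_bounded_integrable => //.
- by rewrite -ge0_fin_numE// fin_num_measure.
- exact: measurable_funTS.
- by exists M; split; [exact: num_real|move=> N /ltW MN w _; exact: le_trans MN].
Qed.

Lemma RintegralZD (B : set T) (a b : R) f g : measurable B ->
  bounded_measurable f -> bounded_measurable g ->
  \int[P]_(w in B) (a * f w + b * g w) =
  a * \int[P]_(w in B) f w + b * \int[P]_(w in B) g w.
Proof.
move=> mB bf bg.
rewrite RintegralD//; last 2 first.
- by apply: bounded_measurable_integrable => //; apply: bounded_measurableM;
    [exact: bounded_measurable_cst|].
- by apply: bounded_measurable_integrable => //; apply: bounded_measurableM;
    [exact: bounded_measurable_cst|].
by rewrite !RintegralZl//; exact: bounded_measurable_integrable.
Qed.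

Lemma Rintegral_indicM (B K : set T) g :
  \int[P]_(w in B) (\1_K w * g w) = \int[P]_(w in B `&` K) g w.
Proof.
rewrite Rintegral_mkcondr; apply: eq_Rintegral => w _.
by rewrite patchE indicE; case: (w \in K); rewrite ?mul1r ?mul0r.
Qed.

(** Change of variables along [\1_D * g]: the integral depends only on the law of this product. The
    value 0, taken at every point outside [D], is cut off because it contributes nothing. *)
Lemma ge0_integral_law (D : set T) (g : T -> R) :
  measurable D -> measurable_fun setT g -> (forall w, 0 <= g w) ->
  (\int[P]_(w in D) (g w)%:E =
   \int[pushforward P (fun w => \1_D w * g w : R)%R]_(y in `]0%R, +oo[) (y%:E))%E.
Proof.
move=> mD mg g0; pose h w : R := \1_D w * g w; rewrite -[X in pushforward P X]/h.
have mh : measurable_fun setT h.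
  by apply: measurable_funM => //; exact: measurable_indic.
rewrite ge0_integral_pushforward//; last first.
  by move=> y; rewrite inE/= in_itv/= andbT lee_fin => /ltW.
rewrite [LHS]integral_mkcond [RHS]integral_mkcond; apply: eq_integral => w _.
rewrite !patchE; have -> : (w \in h @^-1` `]0, +oo[) = (0 < h w).
  by apply/idP/idP; rewrite inE /= in_itv /= andbT.
rewrite /= /h indicE; case: (w \in D) => /=; last by rewrite mul0r ltxx.
rewrite mul1r lt_neqAle g0 andbT eq_sym.
by case: eqP => [->|_].
Qed.

(* Only nonzero values matter, so that the law of [\1_(B `&` K) * g] may be
   compared with a multiple of the law of [\1_B * g]. *)
Lemma ge0_integral_indep (B K : set T) (g : T -> R) :
  measurable B -> measurable K ->
  measurable_fun setT g -> (forall w, 0 <= g w) ->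
  (forall S : set R, measurable S ->
    P (K `&` (B `&` g @^-1` S)) = (P K * P (B `&` g @^-1` S))%E) ->
  (\int[P]_(w in B `&` K) (g w)%:E = P K * \int[P]_(w in B) (g w)%:E)%E.
Proof.
move=> mB mK mg g0 ind.
have mlaw (D : set T) : measurable D ->
    measurable_fun setT (fun w => \1_D w * g w : R).
  by move=> mD; apply: measurable_funM => //; exact: measurable_indic.
(* Outside [D] the product is 0, which does not lie in [S]. *)
have lawE (D : set T) (S : set R) : S `<=` `]0, +oo[ ->
    (fun w => \1_D w * g w : R) @^-1` S = D `&` g @^-1` S.
  move=> S0; apply/seteqP; split => w /=; rewrite indicE.
    case: (boolP (w \in D)) => [/set_mem Dw|_]; first by rewrite mul1r.
    by rewrite mul0r => /S0; rewrite /= in_itv/= ltxx.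
  by move=> [Dw]; rewrite mem_set// mul1r.
have mBK : measurable (B `&` K) by exact: measurableI.
pose nu := measure_function_pushforward__canonical__measure_function_Measure
  P (mlaw B mB).
pose nuK := measure_function_pushforward__canonical__measure_function_Measure
  P (mlaw _ mBK).
have PK0 : 0 <= fine (P K) by rewrite fine_ge0.
rewrite !ge0_integral_law//.
(* By independence, the law for [B] and [K] together is [P K] times the law for [B] on sets of
   positive reals. *)
rewrite (@eq_measure_integral _ _ _ _ (mscale (NngNum PK0) nu) nuK).
  rewrite ge0_integral_mscale//=; last first.
    by move=> y; rewrite /= in_itv/= andbT lee_fin => /ltW.
  by rewrite fineK// fin_num_measure.
move=> S mS S0.
rewrite /nuK /nu /= /pushforward !lawE//.
transitivity ((fine (P K))%:E * P (B `&` g @^-1` S))%E.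
  by rewrite fineK ?fin_num_measure// -ind// setIA [K `&` B]setIC.
by rewrite /mscale /= /pushforward lawE.
Qed.

(** Reduction to the nonnegative case by adding the bound [M] to [g]; the contribution of [M] is
    then cancelled. *)
Lemma Rintegral_indep (B K : set T) g :
  measurable B -> measurable K -> bounded_measurable g ->
  (forall S : set R, measurable S ->
    P (K `&` (B `&` g @^-1` S)) = (P K * P (B `&` g @^-1` S))%E) ->
  \int[P]_(w in B `&` K) g w = fine (P K) * \int[P]_(w in B) g w.
Proof.
move=> mB mK bg ind; have [mg [M gM]] := bg.
have mBK : measurable (B `&` K) by exact: measurableI.
have bM := bounded_measurable_cst M.
(* The factors 1 give the sum the shape required by [RintegralZD]. *)
have bgM : bounded_measurable (fun w => 1 * g w + 1 * M).
  by apply: bounded_measurableD; apply: bounded_measurableM => //;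
    exact: bounded_measurable_cst.
have key : \int[P]_(w in B `&` K) (1 * g w + 1 * M) =
           fine (P K) * \int[P]_(w in B) (1 * g w + 1 * M).
  rewrite /Rintegral ge0_integral_indep//.
  - rewrite fineM// ?fin_num_measure// integrable_fin_num//.
    exact: (@bounded_measurable_integrable P B _ mB bgM).
  - by have [] := bgM.
  - move=> w; rewrite !mul1r -lerBlDr sub0r.
    by have /ler_normlP[] := gM w; rewrite lerNl.
  - move=> S mS.
    have -> : (fun w => 1 * g w + 1 * M) @^-1` S =
              g @^-1` ((fun y => y + M) @^-1` S).
      by apply/seteqP; split => w /=; rewrite !mul1r.
    apply: ind; rewrite -[X in measurable X]setTI.
    by apply: measurable_funD => //; exact: measurable_cst.
(* The hypothesis at [S = setT] says that [B] and [K] are independent, which settles the constant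
   part. *)
have PBK : fine (P (B `&` K)) = fine (P K) * fine (P B).
  have := ind setT measurableT; rewrite preimage_setT setIT setIC => ->.
  by rewrite fineM// fin_num_measure.
move: key; rewrite !RintegralZD// !Rintegral_cst// !mul1r PBK.
by rewrite mulrDr mulrCA => /addIr.
Qed.

End RealIntegrals.

(** * Complex integrals, and conditional averages under linear maps *)

Section ComplexIntegrals.
Context {R : realType} {d : measure_display} {T : measurableType d}.
Variable P : probability T R.

Lemma complex_ReM (a b : R[i]) :
  complex.Re (a * b) = complex.Re a * complex.Re b - complex.Im a * complex.Im b.
Proof. by case: a => ? ?; case: b. Qed.

Lemma complex_ImM (a b : R[i]) :
  complex.Im (a * b) = complex.Re a * complex.Im b + complex.Im a * complex.Re b.
Proof. by case: a => ? ?; case: b. Qed.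

Lemma complex_ReD (a b : R[i]) :
  complex.Re (a + b) = complex.Re a + complex.Re b.
Proof. by case: a => ? ?; case: b. Qed.

Lemma complex_ImD (a b : R[i]) :
  complex.Im (a + b) = complex.Im a + complex.Im b.
Proof. by case: a => ? ?; case: b. Qed.

Definition complex_bounded_measurable (h : T -> R[i]) : Prop :=
  bounded_measurable (fun w => complex.Re (h w)) /\
  bounded_measurable (fun w => complex.Im (h w)).

Definition complex_integral (B : set T) (h : T -> R[i]) : R[i] :=
  Complex (\int[P]_(w in B) complex.Re (h w)) (\int[P]_(w in B) complex.Im (h w)).

Lemma bounded_measurableZ (a : R) (f : T -> R) :
  bounded_measurable f -> bounded_measurable (fun w => a * f w).
Proof. exact/bounded_measurableM/bounded_measurable_cst. Qed.

(** Written as nested combinations of two terms, the shape of [RintegralZD], and as an equality of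
    functions so that it rewrites under the integral. *)
Lemma complex_ReZD (a : R[i]) (f g : T -> R[i]) :
  (fun w => complex.Re (a * f w + g w)) =
  (fun w => 1 * (complex.Re a * complex.Re (f w) +
                 - complex.Im a * complex.Im (f w)) + 1 * complex.Re (g w)).
Proof. by apply/funext => w; rewrite complex_ReD complex_ReM !mul1r mulNr. Qed.

Lemma complex_ImZD (a : R[i]) (f g : T -> R[i]) :
  (fun w => complex.Im (a * f w + g w)) =
  (fun w => 1 * (complex.Re a * complex.Im (f w) +
                 complex.Im a * complex.Re (f w)) + 1 * complex.Im (g w)).
Proof. by apply/funext => w; rewrite complex_ImD complex_ImM !mul1r. Qed.

Lemma complex_bounded_measurableZD a f g :
  complex_bounded_measurable f -> complex_bounded_measurable g ->
  complex_bounded_measurable (fun w => a * f w + g w).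
Proof.
move=> [rf jf] [rg jg]; split; rewrite ?complex_ReZD ?complex_ImZD;
  by do !apply: bounded_measurableD || apply: bounded_measurableZ.
Qed.

Lemma complex_integralZD (B : set T) a f g : measurable B ->
  complex_bounded_measurable f -> complex_bounded_measurable g ->
  complex_integral B (fun w => a * f w + g w) =
  a * complex_integral B f + complex_integral B g.
Proof.
move=> mB [rf jf] [rg jg].
rewrite /complex_integral complex_ReZD complex_ImZD.
rewrite !RintegralZD//; try by do !
  apply: bounded_measurableD || apply: bounded_measurableZ.
rewrite !mul1r; apply/eqP; rewrite eq_complex complex_ReD complex_ImD.
by rewrite complex_ReM complex_ImM /= mulNr !eqxx.
Qed.

Lemma complex_integral_cst (B : set T) (c : R[i]) : measurable B ->
  complex_integral B (fun=> c) = c * (fine (P B))%:C%C.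
Proof.
move=> mB; rewrite /complex_integral !Rintegral_cst//.
apply/eqP.
by rewrite eq_complex complex_ReM complex_ImM /= !mulr0 subr0 add0r !eqxx.
Qed.

Lemma complex_bounded_measurable_lincomb (I : Type) (s : seq I)
    (c : I -> R[i]) (F : I -> T -> R[i]) :
  (forall i, complex_bounded_measurable (F i)) ->
  complex_bounded_measurable (fun w => \sum_(i <- s) c i * F i w).
Proof.
move=> bF; elim: s => [|i s IH].
  under eq_fun do rewrite big_nil.
  by split; exact: bounded_measurable_cst.
under eq_fun do rewrite big_cons.
exact: complex_bounded_measurableZD.
Qed.

Lemma complex_integral_lincomb (B : set T) (I : Type) (s : seq I)
    (c : I -> R[i]) (F : I -> T -> R[i]) : measurable B ->
  (forall i, complex_bounded_measurable (F i)) ->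
  complex_integral B (fun w => \sum_(i <- s) c i * F i w) =
  \sum_(i <- s) c i * complex_integral B (F i).
Proof.
move=> mB bF; elim: s => [|i s IH].
  under eq_fun do rewrite big_nil.
  by rewrite complex_integral_cst// mul0r big_nil.
under eq_fun do rewrite big_cons.
rewrite big_cons complex_integralZD//; last first.
  exact: complex_bounded_measurable_lincomb.
by rewrite IH.
Qed.

Lemma complex_bounded_measurable_indicM (K : set T) h : measurable K ->
  complex_bounded_measurable h ->
  complex_bounded_measurable (fun w => (\1_K w)%:C%C * h w).
Proof.
move=> mK [rh jh]; split.
- under eq_fun do rewrite complex_ReM /= mul0r subr0.
  by apply: bounded_measurableM => //; exact: bounded_measurable_indic.
- under eq_fun do rewrite complex_ImM /= mul0r addr0.
  by apply: bounded_measurableM => //; exact: bounded_measurable_indic.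
Qed.

(** The integral is taken on each part separately, so independence is asked of the real and
    imaginary parts one at a time, not of their joint law. *)
Lemma complex_integral_indep (B K : set T) h :
  measurable B -> measurable K -> complex_bounded_measurable h ->
  (forall S : set R, measurable S ->
    P (K `&` (B `&` [set w | S (complex.Re (h w))])) =
      (P K * P (B `&` [set w | S (complex.Re (h w))]))%E /\
    P (K `&` (B `&` [set w | S (complex.Im (h w))])) =
      (P K * P (B `&` [set w | S (complex.Im (h w))]))%E) ->
  complex_integral B (fun w => (\1_K w)%:C%C * h w) =
  (fine (P K))%:C%C * complex_integral B h.
Proof.
move=> mB mK [rh jh] ind; rewrite /complex_integral.
under [X in Complex X _]eq_Rintegral do rewrite complex_ReM /= mul0r subr0.
under [X in Complex _ X]eq_Rintegral do rewrite complex_ImM /= mul0r addr0.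
rewrite !Rintegral_indicM !Rintegral_indep//; last 2 first.
- by move=> S /ind[].
- by move=> S /ind[].
apply/eqP.
by rewrite eq_complex complex_ReM complex_ImM /= !mul0r subr0 addr0 !eqxx.
Qed.

Definition bounded_measurable_state m (f : T -> 'M[R[i]]_m) : Prop :=
  forall i j, complex_bounded_measurable (fun w => f w i j).

Lemma cond_stateE m (B : set T) (f : T -> 'M[R[i]]_m) :
  cond_state P B f =
  \matrix_(i, j) (complex_integral B (fun w => f w i j) / (fine (P B))%:C%C).
Proof.
apply/matrixP => i j; rewrite !mxE -(fmorphV (real_complex R)).
apply/eqP.
by rewrite eq_complex complex_ReM complex_ImM /= !mulr0 subr0 add0r !eqxx.
Qed.

(** Expansion on the basis [delta_mx]: each entry of [F M] is a combination of entries of [M] with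
    constant coefficients, hence commutes with integration. *)
Lemma linear_entryE m p (F : 'M[R[i]]_m -> 'M[R[i]]_p) M i j : linear F ->
  F M i j = \sum_(kl : 'I_m * 'I_m) F (delta_mx kl.1 kl.2) i j * M kl.1 kl.2.
Proof.
move=> linF.
pose F' : {linear 'M[R[i]]_m -> 'M[R[i]]_p} :=
  HB.pack F (GRing.isLinear.Build _ _ _ _ F linF).
have FE u : F u = F' u by [].
rewrite {1}(matrix_sum_delta M) pair_bigA FE linear_sum summxE.
by apply: eq_bigr => kl _; rewrite (linearZ_LR F') mxE mulrC.
Qed.

Lemma cond_state_linear m p (B : set T) (F : 'M[R[i]]_m -> 'M[R[i]]_p)
    (f : T -> 'M[R[i]]_m) :
  linear F -> measurable B -> bounded_measurable_state f ->
  cond_state P B (fun w => F (f w)) = F (cond_state P B f).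
Proof.
move=> linF mB bf; rewrite !cond_stateE; apply/matrixP => i j.
rewrite mxE [RHS]linear_entryE//.
under [X in complex_integral _ X]eq_fun do rewrite linear_entryE//.
rewrite complex_integral_lincomb// mulr_suml.
by apply: eq_bigr => kl _; rewrite mxE mulrA.
Qed.

End ComplexIntegrals.

(** * Uniform bounds on the entries of density matrices *)

Section Density.
Variable R : realType.

Lemma density_diag m (rho : 'M[R[i]]_m) k :
  density rho -> 0 <= rho k k <= 1.
Proof.
move=> [_ rho0 trrho].
have ge0 l : 0 <= rho l l.
  have := rho0 (delta_mx l 0).
  by rewrite trmx_delta map_delta_mx -rowE -colE !mxE.
rewrite ge0 /= -trrho /mxtrace (bigD1 k)//= lerDl.
by apply: sumr_ge0.
Qed.

(** Positivity on the test vector [e_i + c e_j] with [|c| = 1] gives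
    [0 <= rho_ii + rho_jj + 2 Re (c rho_ij)], and both diagonal entries are at most 1. *)
Lemma density_Re_bound m (rho : 'M[R[i]]_m) (c : R[i]) i j :
  density rho -> c * c^* = 1 -> - 1 <= complex.Re (c * rho i j).
Proof.
move=> rhoD cc; have [rhoH rho0 _] := rhoD.
have := rho0 (delta_mx i 0 + c *: delta_mx j 0).
have -> : (delta_mx i 0 + c *: delta_mx j 0 : 'cV[R[i]]_m) ^t* =
    delta_mx 0 i + c^* *: delta_mx 0 j.
  by rewrite linearD linearZ /= map_mxD map_mxZ !trmx_delta !map_delta_mx.
rewrite !(mulmxDl, mulmxDr) -!(scalemxAl, scalemxAr) -!rowE -!colE.
rewrite !mxE.
have -> : rho j i = (rho i j)^* by rewrite -[in LHS]rhoH !mxE.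
have /andP[_] := density_diag i rhoD; have /andP[_] := density_diag j rhoD.
rewrite -rmorphM [c^* * _]mulrA [c^* * c]mulrC cc mul1r.
have ReJ (u : R[i]) : complex.Re u^* = complex.Re u by case: u.
rewrite !lecE => /andP[_ /= rj] /andP[_ ri] /andP[_].
rewrite !complex_ReD ReJ /=; lra.
Qed.

Lemma density_bound m (rho : 'M[R[i]]_m) i j : density rho ->
  `|complex.Re (rho i j)| <= 1 /\ `|complex.Im (rho i j)| <= 1.
Proof.
move=> rhoD.
have bnd (a b : R) : a ^+ 2 + b ^+ 2 = 1 ->
    - 1 <= a * complex.Re (rho i j) - b * complex.Im (rho i j).
  move=> ab; rewrite -(complex_ReM (a +i* b)%C); apply: density_Re_bound => //.
  by apply/eqP; rewrite eq_complex /=; apply/andP; split; apply/eqP; lra.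
(* The phases 1, -1, i and -i bound the real and imaginary parts from both sides. *)
have b1 := bnd 1 0; have b2 := bnd (-1) 0.
have b3 := bnd 0 1; have b4 := bnd 0 (-1).
by split; rewrite ler_norml; apply/andP; split; lra.
Qed.

End Density.

(** * The encrypted register on reception *)

Section EncryptedRegister.
Context {R : realType} {d : measure_display} {T : measurableType d}.
Variable P : probability T R.
Context {n : nat} {dL : measure_display} {Lam : measurableType dL}.
Variables (L : {RV P >-> Lam}) (x z : {RV P >-> n.-tuple bool}).
Variable rho : T -> 'M[R[i]]_(2 ^ n).
Hypothesis rhoD : forall w, density (rho w).
Hypothesis mrho : measurable_state rho.
Hypothesis ukeys : uniform_keys P x z.
Hypothesis ikeys : independent_keys P x z L rho.

Let events := leakage_plaintext_events L rho.

Lemma measurable_key_event a b : measurable (key_event x z a b).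
Proof.
have mtuple (y : {RV P >-> n.-tuple bool}) (t : n.-tuple bool) :
    measurable [set w | y w = t].
  have /measurable_fun_tnthP my : measurable_fun setT y by [].
  (* A random tuple is measurable through its coordinates, so the event is split into finitely many
     coordinate events. *)
  have -> : [set w | y w = t] =
      \bigcap_(i in [set: 'I_n]) ((@tnth n bool)^~ i \o y) @^-1` [set tnth t i].
    apply/seteqP; split => w /= yt; first by move=> i _ /=; rewrite yt.
    by apply: eq_from_tnth => i; exact: yt.
  apply: fin_bigcap_measurable => // i _.
  by rewrite -[X in measurable X]setTI; exact: my.
exact: (measurableI _ _ (mtuple x a) (mtuple z b)).
Qed.

Lemma bounded_measurable_plaintext : bounded_measurable_state rho.
Proof.
by move=> i j; split; (split; first by have [] := mrho i j);
  exists 1 => w; have [] := density_bound i j (rhoD w).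
Qed.

Lemma events_measurable B : events B -> measurable B.
Proof.
apply: smallest_sub; first exact: sigma_algebra_measurable.
move=> S [[A mA ->]|[i [j [A [mA]]]]].
  by rewrite -[X in measurable X]setTI; exact: measurable_funP.
have [mre mim] := mrho i j.
by case=> ->; rewrite -[X in measurable X]setTI; [exact: mre|exact: mim].
Qed.

Lemma eventsI B D : events B -> events D -> events (B `&` D).
Proof. exact: (@measurableI _ (g_sigma_algebraType _)). Qed.

(** Cutting [B] by a condition on an entry of [rho] stays within [events], so the key is independent
    of the result and its probability factors out. *)
Lemma complex_integral_key a b B i j : events B ->
  complex_integral P B (fun w => (\1_(key_event x z a b) w)%:C%C * rho w i j) =
  ((4 ^ n)%:R^-1 : R)%:C%C * complex_integral P B (fun w => rho w i j).
Proof.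
move=> eB; rewrite complex_integral_indep.
- by congr (_%:C%C * _); rewrite ukeys.
- exact: events_measurable.
- exact: measurable_key_event.
- exact: bounded_measurable_plaintext.
- by move=> S mS; split; apply: ikeys; apply: eventsI => //;
    apply: sub_sigma_algebra; right; exists i, j, S; split => //; [left|right].
Qed.

(** Trades the random key for a sum over fixed keys weighted by indicators, of which exactly one is
    nonzero. The Pauli coefficients become constants that leave the integral. *)
Lemma sent_entryE w i j :
  qotp (x w) (z w) (rho w) i j =
  \sum_(q : (n.-tuple bool * n.-tuple bool) * ('I_(2 ^ n) * 'I_(2 ^ n)))
    (pauli R[i] q.1.1 q.1.2 i q.2.1 * (pauli R[i] q.1.1 q.1.2 j q.2.2)^*) *
    ((\1_(key_event x z q.1.1 q.1.2) w)%:C%C * rho w q.2.1 q.2.2).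
Proof.
rewrite -(pair_bigA _ (fun p kl =>
  (pauli R[i] p.1 p.2 i kl.1 * (pauli R[i] p.1 p.2 j kl.2)^*) *
  ((\1_(key_event x z p.1 p.2) w)%:C%C * rho w kl.1 kl.2))) /=.
rewrite (bigD1 (x w, z w))//= [X in _ + X]big1 ?addr0 => [|[a b] neq]; last first.
  rewrite big1// => kl _; rewrite indicE memNset ?mul0r ?mulr0//.
  by move=> [/= xa zb]; move: neq; rewrite -xa -zb eqxx.
rewrite /qotp conjugate_byE pair_bigA /=.
by apply: eq_bigr => kl _; rewrite indicE mem_set// mul1r.
Qed.

Lemma bounded_measurable_sent :
  bounded_measurable_state (fun w => qotp (x w) (z w) (rho w)).
Proof.
move=> i j; under eq_fun do rewrite sent_entryE.
apply: complex_bounded_measurable_lincomb => q.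
apply: complex_bounded_measurable_indicM; first exact: measurable_key_event.
exact: bounded_measurable_plaintext.
Qed.

Lemma complex_integral_trace B : measurable B ->
  \sum_k complex_integral P B (fun w => rho w k k) = (fine (P B))%:C%C.
Proof.
move=> mB; under eq_bigr do rewrite -[complex_integral _ _ _]mul1r.
rewrite -(@complex_integral_lincomb _ _ _ P B _ _ _ (fun k w => rho w k k))//;
  last first.
  by move=> k; exact: bounded_measurable_plaintext.
rewrite -[RHS]mul1r -complex_integral_cst//; congr complex_integral.
apply/funext => w; have [_ _ tr1] := rhoD w.
rewrite -[RHS]tr1.
by apply: eq_bigr => k _; rewrite mul1r.
Qed.

(** Here [B] may restrict the plaintext as well as the leakage, so the ciphertext average also hides
    the plaintext. *)
Lemma cond_state_sent B : events B -> (0 < P B)%E ->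
  cond_state P B (fun w => qotp (x w) (z w) (rho w)) = max_mixed R[i] n.
Proof.
move=> eB PB0; have mB := events_measurable eB.
have PB_neq0 : (fine (P B))%:C%C != 0 :> R[i].
  rewrite (fmorph_eq0 (real_complex R)) gt_eqF// fine_gt0// PB0.
  by rewrite -ge0_fin_numE// fin_num_measure.
rewrite cond_stateE; apply/matrixP => i j; rewrite !mxE.
under [X in complex_integral _ _ X]eq_fun do rewrite sent_entryE.
rewrite complex_integral_lincomb//; last first.
  move=> q; apply: complex_bounded_measurable_indicM.
    exact: measurable_key_event.
  exact: bounded_measurable_plaintext.
under eq_bigr do rewrite complex_integral_key//.
(* The key sum is moved inside, where only Pauli entries depend on the key and [pauli_sum]
   applies. *)
rewrite -(pair_bigA _ (fun p kl =>
  (pauli R[i] p.1 p.2 i kl.1 * (pauli R[i] p.1 p.2 j kl.2)^*) *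
  (((4 ^ n)%:R^-1 : R)%:C%C *
   complex_integral P B (fun w => rho w kl.1 kl.2)))) /= exchange_big /=.
under eq_bigr do rewrite -mulr_suml pauli_sum.
rewrite -(pair_bigA _ (fun k l => (2 ^ n)%:R * ((i == j) && (k == l))%:R *
  (((4 ^ n)%:R^-1 : R)%:C%C *
   complex_integral P B (fun w => rho w k l)))) /=.
under eq_bigr => k _.
  rewrite (bigD1 k)//= eqxx andbT [X in _ + X]big1 ?addr0 => [|l lk]; last first.
    by rewrite [k == l]eq_sym (negPf lk) andbF mulr0 mul0r.
  over.
(* The surviving diagonal terms add up to the integrated trace [P B], which cancels the
   normalization; the constant left is [2^n / 4^n = 1 / 2^n]. *)
rewrite -mulr_sumr -mulr_sumr complex_integral_trace// -!mulrA mulfV// mulr1.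
rewrite (fmorphV (real_complex R)) (rmorph_nat (real_complex R)).
rewrite (expnMn 2 2) natrM invfM.
by rewrite mulrCA mulVKf ?pnatr_eq0 ?expn_eq0// mulr_natl.
Qed.

End EncryptedRegister.

(** * Secrecy against the honest-but-curious server *)

Lemma prefix_clifford_unitary (R : realType) (n : nat)
    (s cs : seq 'M[R[i]]_(2 ^ n)) :
  (forall G, G \in s -> clifford G) -> prefix cs s ->
  {in cs, forall G, G \is unitarymx}.
Proof.
move=> cliff /prefixP[s' sE] G Gcs.
by have [] : clifford G by apply: cliff; rewrite sE mem_cat Gcs.
Qed.

(** The instructions are a function [instr] of the leakage, and a prefix [cs] common to all values
    in [A] describes any intermediate moment. The last clause expresses that only the leakage
    remains: refining [A] by events about the plaintext changes neither the register nor its joint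
    state with the kept environment. *)
Theorem theorem1 (R : realType) (n : nat)
    (d : measure_display) (T : measurableType d) (P : probability T R)
    (dL : measure_display) (Lam : measurableType dL) (L : {RV P >-> Lam})
    (x z : {RV P >-> n.-tuple bool})
    (rho : T -> 'M[R[i]]_(2 ^ n))
    (instr : Lam -> seq 'M[R[i]]_(2 ^ n)) :
  (forall w, density (rho w)) ->
  measurable_state rho ->
  uniform_keys P x z ->
  independent_keys P x z L rho ->
  (forall l G, G \in instr l -> clifford G) ->
  let sent := fun w => qotp (x w) (z w) (rho w) in
  forall (A : set Lam) (cs : seq 'M[R[i]]_(2 ^ n)),
    measurable A -> (0 < P (L @^-1` A))%E ->
    (forall l, A l -> prefix cs (instr l)) ->
    [/\ cond_state P (L @^-1` A) sent = max_mixed R[i] n,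
        cond_state P (L @^-1` A) (fun w => strict_run cs (sent w))
          = max_mixed R[i] n,
        forall Ds : seq (dilation R[i] n), implements_seq Ds cs ->
          cond_state P (L @^-1` A) (fun w => ptrace (purified_run Ds (sent w)))
            = max_mixed R[i] n
      & forall B : set T, leakage_plaintext_events L rho B ->
          B `<=` L @^-1` A -> (0 < P B)%E ->
          [/\ cond_state P B sent = max_mixed R[i] n,
              cond_state P B (fun w => strict_run cs (sent w)) = max_mixed R[i] n
            & forall Ds : seq (dilation R[i] n), implements_seq Ds cs ->
                cond_state P B (fun w => purified_run Ds (sent w))
                  = purified_run Ds (max_mixed R[i] n)]].
Proof.
move=> rhoD mrho ukeys ikeys cliff sent A cs mA PA0 csA.
(* Positive probability provides an actual leakage value in [A], whose instructions start with [cs];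
   this makes the gates of [cs] unitary. *)
have [w0 Aw0] : (L @^-1` A) !=set0.
  by apply/set0P/eqP => A0; move: PA0; rewrite A0 measure0 ltxx.
have csU := prefix_clifford_unitary (cliff _) (csA _ Aw0).
have bsent := bounded_measurable_sent x z rhoD mrho : bounded_measurable_state sent.
have onEvent B : leakage_plaintext_events L rho B -> (0 < P B)%E ->
    measurable B /\ cond_state P B sent = max_mixed R[i] n.
  move=> eB PB0; split; first exact: events_measurable eB.
  exact: cond_state_sent eB PB0.
have eA : leakage_plaintext_events L rho (L @^-1` A).
  by apply: sub_sigma_algebra; left; exists A.
have [mLA sentA] := onEvent _ eA PA0.
split => //.
- rewrite (cond_state_linear _ (strict_run_linear cs) mLA bsent) sentA.
  exact: strict_run_max_mixed.
- move=> Ds impl.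
  have lin : linear (fun M => ptrace (purified_run Ds M)).
    by move=> a u v; rewrite purified_run_linear ptrace_linear.
  rewrite (cond_state_linear _ lin mLA bsent) sentA.
  exact: ptrace_purified_run impl csU.
(* The average over [B] passes through each linear run, and the averaged input is the same for every
   such [B]. *)
- move=> B eB _ PB0; have [mB sentB] := onEvent _ eB PB0; split => //.
    rewrite (cond_state_linear _ (strict_run_linear cs) mB bsent) sentB.
    exact: strict_run_max_mixed.
  move=> Ds _.
  by rewrite (cond_state_linear _ (purified_run_linear Ds) mB bsent) sentB.
Qed.
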